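(* Let $A_{+irr}(x,y)=\sum_{n,k\ge 0} a_{n,k}x^n y^k$, where $a_{n,k}$ is the number of plus irreducible $321$-avoiding permutations having exactly $n$ left-to-right maxima and exactly $k$ other elements (the empty permutation is included, contributing $1$). Then, as formal power series, $$y(x+1)\,A_{+irr}^2-(xy+2y+1)\,A_{+irr}+(x+1)(y+1)=0 .$$
   Context: A permutation $\pi=p_1p_2\cdots p_m$ of $\{1,\dots,m\}$ is written in one-line notation. It avoids $321$ if there are no indices $i<j<k$ with $p_i>p_j>p_k$. An entry $p_i$ is a left-to-right maximum if $p_i>p_j$ for all $j<i$. A permutation $\pi$ is plus irreducible if it contains no two consecutive entries of the form $i\,(i+1)$, i.e. there is no index $j$ with $p_{j+1}=p_j+1$. *)

(* Defs.v *)
From HB Require Import structures.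
From mathcomp Require Import all_boot all_order all_algebra all_fingroup.
From mathcomp Require Import boolp.

Set Implicit Arguments.
Unset Strict Implicit.
Unset Printing Implicit Defensive.

Import GRing.Theory.
Local Open Scope ring_scope.

(** * Formal power series in two commuting variables *)

(* [f n k] is the coefficient of x^n y^k in [f]. *)
Record fps2 (R : Type) := Fps2 { fps2_coef :> nat -> nat -> R }.

HB.instance Definition _ (R : Type) := gen_eqMixin (fps2 R).
HB.instance Definition _ (R : Type) := gen_choiceMixin (fps2 R).

Lemma fps2P (R : Type) (f g : fps2 R) : (forall n k, f n k = g n k) <-> f = g.
Proof.
split=> [|-> //]; case: f g => f [g] /= efg; congr Fps2.
by apply: functional_extensionality_dep => n;
   apply: functional_extensionality_dep => k.
Qed.

Section Zmodule.
Variable R : zmodType.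
Implicit Types f g h : fps2 R.

Definition fps2_zero : fps2 R := Fps2 (fun _ _ => 0).
Definition fps2_add f g : fps2 R := Fps2 (fun n k => f n k + g n k).
Definition fps2_opp f : fps2 R := Fps2 (fun n k => - f n k).

Fact fps2_addA : associative fps2_add.
Proof. by move=> f g h; apply/fps2P => n k; apply: addrA. Qed.

Fact fps2_addC : commutative fps2_add.
Proof. by move=> f g; apply/fps2P => n k; apply: addrC. Qed.

Fact fps2_add0 : left_id fps2_zero fps2_add.
Proof. by move=> f; apply/fps2P => n k; apply: add0r. Qed.

Fact fps2_addN : left_inverse fps2_zero fps2_opp fps2_add.
Proof. by move=> f; apply/fps2P => n k; apply: addNr. Qed.

HB.instance Definition _ := GRing.isZmodule.Build (fps2 R)
  fps2_addA fps2_addC fps2_add0 fps2_addN.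

End Zmodule.

Section Ring.
Variable R : comNzRingType.
Implicit Types f g h : fps2 R.

Definition fps2_monom (i j : nat) : fps2 R :=
  Fps2 (fun n k => ((n == i) && (k == j))%:R).

Definition fps2_mul f g : fps2 R :=
  Fps2 (fun n k => \sum_(i < n.+1) \sum_(j < k.+1) f i j * g (n - i)%N (k - j)%N).

(* The ring axioms are transferred from {poly {poly R}} by truncation. *)
Let trunc n k f : {poly {poly R}} := \poly_(i < n.+1) \poly_(j < k.+1) f i j.

Let truncE n k f i j : (i <= n)%N -> (j <= k)%N -> (trunc n k f)`_i`_j = f i j.
Proof. by move=> le_in le_jk; rewrite coef_poly ltnS le_in coef_poly ltnS le_jk. Qed.

Let coefM2 (p q : {poly {poly R}}) n k : (p * q)`_n`_k =
  \sum_(i < n.+1) \sum_(j < k.+1) p`_i`_j * q`_(n - i)`_(k - j).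
Proof. by rewrite coefM coef_sum; apply: eq_bigr => i _; rewrite coefM. Qed.

Let mulE n k f g i j : (i <= n)%N -> (j <= k)%N ->
  (trunc n k f * trunc n k g)`_i`_j = fps2_mul f g i j.
Proof.
move=> le_in le_jk; rewrite coefM2 /=.
apply: eq_bigr => a _; apply: eq_bigr => b _.
have le_ai : (a <= i)%N by rewrite -ltnS.
have le_bj : (b <= j)%N by rewrite -ltnS.
by rewrite !truncE // ?(leq_trans (leq_subr _ _)) ?(leq_trans le_ai) ?(leq_trans le_bj).
Qed.

Fact fps2_mulC : commutative fps2_mul.
Proof. by move=> f g; apply/fps2P => n k; rewrite -!(@mulE n k) // mulrC. Qed.

Let mulE3 n k f g h :
  (trunc n k f * trunc n k g * trunc n k h)`_n`_k = fps2_mul (fps2_mul f g) h n k.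
Proof.
rewrite coefM2; apply: eq_bigr => a _; apply: eq_bigr => b _.
have le_an : (a <= n)%N by rewrite -ltnS.
have le_bk : (b <= k)%N by rewrite -ltnS.
by rewrite mulE // truncE // leq_subr.
Qed.

Fact fps2_mulA : associative fps2_mul.
Proof.
move=> f g h; apply/fps2P => n k.
by rewrite fps2_mulC -!mulE3 [_ * trunc n k f]mulrC mulrA.
Qed.

Fact fps2_mul1 : left_id (fps2_monom 0 0) fps2_mul.
Proof.
move=> f; apply/fps2P => n k /=.
rewrite big_ord_recl [X in _ + X]big1 => [|i _]; last first.
  by rewrite big1 // => j _; rewrite mul0r.
rewrite addr0 big_ord_recl [X in _ + X]big1 => [|j _]; last by rewrite mul0r.
by rewrite addr0 mul1r !subn0.
Qed.

Fact fps2_mulDl : left_distributive fps2_mul (@fps2_add R).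
Proof.
move=> f g h; apply/fps2P => n k /=; rewrite -big_split.
by apply: eq_bigr => i _; rewrite -big_split; apply: eq_bigr => j _; apply: mulrDl.
Qed.

Fact fps2_1neq0 : fps2_monom 0 0 != 0.
Proof. by apply/eqP => /fps2P /(_ 0 0)%N /eqP; rewrite oner_eq0. Qed.

HB.instance Definition _ := GRing.Zmodule_isComNzRing.Build (fps2 R)
  fps2_mulA fps2_mulC fps2_mul1 fps2_mulDl fps2_1neq0.

End Ring.

(** * Permutations *)

(* A permutation p_1 ... p_m of {1, ..., m} is encoded, shifting positions and
   values by one, as [s : 'S_m] with p_(i+1) = s i + 1. *)

Section Permutations.
Variable m : nat.
Implicit Type s : 'S_m.

Definition avoids321 s : bool :=
  ~~ [exists i : 'I_m, exists j : 'I_m, exists k : 'I_m,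
       [&& (i < j)%N, (j < k)%N, (s j < s i)%N & (s k < s j)%N]].

Definition ltr_maximum s (i : 'I_m) : bool :=
  [forall j : 'I_m, (j < i)%N ==> (s j < s i)%N].

Definition plus_irreducible s : bool :=
  ~~ [exists j : 'I_m, exists j' : 'I_m,
       (j' == j.+1 :> nat) && (s j' == (s j).+1 :> nat)].

End Permutations.

(* A permutation with n left-to-right maxima and k other elements has length
   n + k. *)
Definition num_plus_irr (n k : nat) : nat :=
  #|[set s : 'S_(n + k)%N | [&& avoids321 s, plus_irreducible s,
       #|[set i | ltr_maximum s i]| == n & #|[set i | ~~ ltr_maximum s i]| == k]]|.

Definition A_plus_irr : fps2 int := Fps2 (fun n k => (num_plus_irr n k)%:Z).

(* Main.v *)
Require Import Defs.
From mathcomp Require Import all_boot all_order all_algebra.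
From mathcomp Require Import all_fingroup.
From mathcomp Require Import ring zify.
Set Implicit Arguments.
Unset Strict Implicit.
Unset Printing Implicit Defensive.
Import GRing.Theory.
Local Open Scope ring_scope.

(** Permutations are grown one last entry at a time: [ext v s] appends an entry
    of value [v] and shifts up by one the old values that are at least [v].  A
    place where a value may be inserted is called a slot.  The slots below
    [low s], that is, below the largest entry that is not a left-to-right
    maximum, would create a 321 pattern (lemma [avoids321_ext]).  Appending at
    the top slot gives a left-to-right maximum, at any other slot an entry that
    is not one.

    A pattern [i (i+1)] inside [s] can be repaired only by an insertion in the
    slot between its two values; such a slot is bad.  An insertion below the
    top closes for good all the slots under it, so it must not jump over a bad
    slot.  Hence the possible completions of [s] depend only on its state: the
    list [flags s] telling which of the slots between [low s] and the top are
    bad, and whether the last entry is the greatest one.  The lemmas [alive_ext_max],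
    [flags_ext_max], [alive_ext_mid] and [flags_ext_mid] describe the moves
    between states, with the weight x for a left-to-right maximum and y for any
    other entry.

    The resulting linear system has a solution in product form.  There are
    series [b] and [c] such that the completions of a state whose last entry is
    the greatest one are counted by [c] times a factor [b] for each bad slot and
    [1 + b] for each good one.  It is enough that c = 1 + x b c and
    b = y (1 + x (1 + b)^2 c), and these equations have a solution since their
    right-hand sides are contractions ([exists_slot_series]).  The lemma
    [state_series_rec] says that the product form satisfies the system, and
    [completions_state_series] that the system determines the counts, degree by
    degree.  The empty permutation gives A = 1 + x c (1 + b) = (1 + x) c, and
    eliminating [b] yields the quadratic equation. *)

(** * Formal power series: homogeneous parts and fixed points *)

Section Series.
Variable R : comNzRingType.
Implicit Types f g : fps2 R.

Lemma coef_fps2D f g n k : (f + g) n k = f n k + g n k. Proof. by []. Qed.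
Lemma coef_fps2M f g n k : (f * g) n k =
  \sum_(i < n.+1) \sum_(j < k.+1) f i j * g (n - i)%N (k - j)%N.
Proof. by []. Qed.

Lemma coef_fps2_sum (I : Type) (r : seq I) (P : pred I) (F : I -> fps2 R) n k :
  (\sum_(i <- r | P i) F i) n k = \sum_(i <- r | P i) F i n k.
Proof. by elim/big_rec2: _ => // i _ f _ <-. Qed.

Lemma coef_fps2_monomM a b f n k : (fps2_monom R a b * f) n k =
  if (a <= n)%N && (b <= k)%N then f (n - a)%N (k - b)%N else 0.
Proof.
rewrite coef_fps2M; case: ifPn => [/andP[le_an le_bk] | out].
  have ltan : (a < n.+1)%N by []. have ltbk : (b < k.+1)%N by [].
  rewrite (bigD1 (Ordinal ltan)) //= (bigD1 (Ordinal ltbk)) //= !eqxx mul1r.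
  rewrite big1 => [|j ne_j]; last first.
    by rewrite [(j : nat) == b](negbTE ne_j) mul0r.
  rewrite addr0 big1 ?addr0 // => i ne_i; apply: big1 => j _.
  by rewrite [(i : nat) == a](negbTE ne_i) mul0r.
apply: big1 => i _; apply: big1 => j _ /=.
case: eqP => [def_i|_]; last by rewrite mul0r.
case: eqP => [def_j|_]; last by rewrite mul0r.
by move: out; rewrite -def_i -def_j !leq_ord.
Qed.

Lemma fps2_monomM a b c d :
  fps2_monom R a b * fps2_monom R c d = fps2_monom R (a + c) (b + d).
Proof.
apply/fps2P => n k; rewrite coef_fps2_monomM /=.
case: ifPn => [/andP[le_an le_bk]|].
  by rewrite -{2}(subnKC le_an) -{2}(subnKC le_bk) !eqn_add2l.
rewrite negb_and -!ltnNge => out; case: eqP => //= n_eq.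
case: eqP => //= k_eq; move: out; rewrite n_eq k_eq.
by rewrite !ltnNge !leq_addr.
Qed.

Definition fps2_X : fps2 R := fps2_monom R 1 0.
Definition fps2_Y : fps2 R := fps2_monom R 0 1.

(** The homogeneous part of total degree [r]. *)
Definition hom r f : fps2 R :=
  Fps2 (fun n k => if (n + k == r)%N then f n k else 0).

Lemma homE r f n k : hom r f n k = if (n + k == r)%N then f n k else 0.
Proof. by []. Qed.

Lemma homD r f g : hom r (f + g) = hom r f + hom r g.
Proof. by apply/fps2P => n k; rewrite coef_fps2D /=; case: ifP; rewrite ?addr0. Qed.

Lemma hom0 r : hom r 0 = 0.
Proof. by apply/fps2P => n k /=; case: ifP. Qed.

Lemma hom_sum r (I : Type) (s : seq I) (P : pred I) (F : I -> fps2 R) :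
  hom r (\sum_(i <- s | P i) F i) = \sum_(i <- s | P i) hom r (F i).
Proof.
by elim/big_rec2: _ => [|i f g _ <-]; [apply: hom0 | apply: homD].
Qed.

Lemma hom_bool r (b : bool) : hom r b%:R = if r is 0 then b%:R else 0.
Proof.
case: b; last by rewrite hom0; case: r.
by apply/fps2P; case: r => [|r] [|n] [|k] //=; rewrite ?if_same.
Qed.

Lemma hom_XM r f : hom r (fps2_X * f) = if r is r'.+1 then fps2_X * hom r' f else 0.
Proof.
apply/fps2P => n k; rewrite homE coef_fps2_monomM.
case: r => [|r]; first by case: n => [|n]; rewrite ?if_same.
by rewrite coef_fps2_monomM; case: n => [|n]; rewrite ?if_same //= !subSS !subn0.
Qed.

Lemma hom_YM r f : hom r (fps2_Y * f) = if r is r'.+1 then fps2_Y * hom r' f else 0.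
Proof.
apply/fps2P => n k; rewrite homE coef_fps2_monomM.
case: r => [|r]; first by case: k => [|k]; rewrite ?addnS ?if_same.
rewrite coef_fps2_monomM; case: k => [|k]; rewrite ?if_same //= !subSS !subn0.
by rewrite addnS.
Qed.

(** Congruence modulo the power series of order at least [d]. *)
Definition agree d f g := forall n k, (n + k < d)%N -> f n k = g n k.

(** The iterates of a contraction stabilize, coefficient by coefficient: the
    coefficient at [(n, k)] is final after [n + k + 1] steps from any start. *)
Lemma fps2_fixpoint (Phi : fps2 R -> fps2 R) :
  (forall d f g, agree d f g -> agree d.+1 (Phi f) (Phi g)) ->
  exists f, f = Phi f.
Proof.
move=> contr; pose it d := iter d Phi 0.
have itS d : agree d (it d) (it d.+1).
  by elim: d => [|d IHd]; [move=> n k; rewrite ltn0 | apply: contr].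
have it_agree d e : (d <= e)%N -> agree d (it d) (it e).
  move=> /subnK <-; elim: (e - d)%N => [|c IHc] // n k lt_d.
  by rewrite IHc // itS // (leq_trans lt_d) // leq_addl.
exists (Fps2 (fun n k => it (n + k).+1 n k)); apply/fps2P => n k.
apply: (contr (n + k)%N (it (n + k)%N)) => // i j lt_ij.
by symmetry; apply: it_agree.
Qed.

Lemma agreeD d f1 f2 g1 g2 :
  agree d f1 f2 -> agree d g1 g2 -> agree d (f1 + g1) (f2 + g2).
Proof. by move=> f12 g12 n k lt_d; rewrite !coef_fps2D f12 // g12. Qed.

Lemma agreeM d f1 f2 g1 g2 :
  agree d f1 f2 -> agree d g1 g2 -> agree d (f1 * g1) (f2 * g2).
Proof.
move=> f12 g12 n k lt_d; rewrite !coef_fps2M.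
apply: eq_bigr => i _; apply: eq_bigr => j _.
rewrite f12 ?g12 //; apply: leq_ltn_trans lt_d; last first.
  by apply: leq_add; rewrite -ltnS.
by apply: leq_add; apply: leq_subr.
Qed.

Lemma agree_monom a b d f g : (0 < a + b)%N ->
  agree d f g -> agree d.+1 (fps2_monom R a b * f) (fps2_monom R a b * g).
Proof.
move=> ab_gt0 fg n k lt_d; rewrite !coef_fps2_monomM; case: ifP => // /andP[le_a le_b].
apply: fg; rewrite -(ltn_add2l (a + b)) addnACA !subnKC //.
by rewrite (leq_ltn_trans (n := d)) // -[d.+1]add1n leq_add2r.
Qed.

(** Solving the second equation needs [c] to be the inverse of [1 - x b], which
    eliminates [c] and leaves one fixed point equation for [b] alone. *)
Lemma exists_slot_series : exists b c : fps2 R,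
  c = 1 + fps2_X * (b * c) /\ b = fps2_Y * (1 + fps2_X * ((1 + b) ^+ 2 * c)).
Proof.
pose Phi b := fps2_X * b ^+ 2 + fps2_Y * (1 + fps2_X * (1 + b + b ^+ 2)).
have [b def_b] : exists b, b = Phi b.
  apply: fps2_fixpoint => d f g fg; have fg2 := agreeM fg fg.
  apply: agreeD; first exact: agree_monom.
  apply: agree_monom => //; apply: agreeD => // n k lt_d.
  apply: (agree_monom (d := d)); rewrite // ?(leq_trans lt_d) //.
  by apply: agreeD => //; apply: agreeD.
have [c def_c] : exists c, c = 1 + fps2_X * (b * c).
  apply: (fps2_fixpoint (Phi := fun c => 1 + fps2_X * (b * c))) => d f g fg.
  by apply: agreeD => //; apply: agree_monom => //; apply: agreeM.
exists b, c; split=> //.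
have inv_c : c * (1 - fps2_X * b) = 1.
  by rewrite mulrBr mulr1 {1}def_c; ring.
have -> : fps2_Y * (1 + fps2_X * ((1 + b) ^+ 2 * c)) =
   c * (fps2_Y * (1 + fps2_X * (1 + b + b ^+ 2))) - fps2_Y * (c * (1 - fps2_X * b) - 1).
  ring.
rewrite inv_c subrr mulr0 subr0.
have -> : fps2_Y * (1 + fps2_X * (1 + b + b ^+ 2)) = b * (1 - fps2_X * b).
  by rewrite mulrBr mulr1 [X in _ = X - _]def_b /Phi; ring.
by rewrite mulrCA inv_c mulr1.
Qed.

End Series.

(** * The product form solution of the system of states *)

Section Weights.
Variable R : comNzRingType.
Local Notation x := (fps2_X R).
Local Notation y := (fps2_Y R).

Definition slots_series (b : fps2 R) (f : seq bool) : fps2 R :=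
  \prod_(bad <- f) (if bad then b else 1 + b).

(** The series of completions of the state with slots [f], listed upwards, whose
    last entry is the greatest one ([l = true]) or not.  For [l = false] the
    lowest slot may not be used in the next step, which is why it contributes a
    different factor. *)
Definition state_series (b c : fps2 R) (l : bool) (f : seq bool) : fps2 R :=
  if l then c * slots_series b f else
  match f with
  | [::] => 1 + x * (c * (1 + b))
  | true :: _ => x * (c * (1 + b) * slots_series b f)
  | false :: f' => (1 + x * ((1 + b) ^+ 2 * c)) * slots_series b f'
  end.

(** The three terms correspond to stopping, appending a new greatest entry, and
    inserting in slot [i].  A new greatest entry opens the slot just below it,
    which is bad exactly when the previous last entry was the greatest one.
    Inserting in slot [i] requires that no bad slot lies below; it closes these
    slots and leaves a good one just above the inserted value.  Slot 0 is
    excluded if the last entry is not the greatest one, for it would put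
    a value right after its predecessor, in a place where no later insertion can
    separate them. *)
Lemma state_series_rec (b c : fps2 R) (l : bool) (f : seq bool) :
  c = 1 + x * (b * c) -> b = y * (1 + x * ((1 + b) ^+ 2 * c)) ->
  state_series b c l f = (~~ has id f)%:R + x * state_series b c true (rcons f l) +
    y * \sum_(i < size f | ~~ has id (take i f) && ((0 < i)%N || l))
           state_series b c false (false :: drop i.+1 f).
Proof.
move=> def_c def_b.
pose K := 1 + x * ((1 + b) ^+ 2 * c).
pose S f := \sum_(i < size f | ~~ has id (take i f))
              state_series b c false (false :: drop i.+1 f).
have slot_nil : slots_series b [::] = 1 by rewrite /slots_series big_nil.
have slot_cons z g : slots_series b (z :: g) = (if z then b else 1 + b) * slots_series b g.
  by rewrite /slots_series big_cons.
have slot_rcons z g : slots_series b (rcons g z) = slots_series b g * (if z then b else 1 + b).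
  by rewrite /slots_series -cats1 big_cat big_seq1.
have S_cons z g : S (z :: g) = K * slots_series b g + (if z then 0 else S g).
  rewrite /S /= big_mkcond big_ord_recl /= drop0; congr (_ + _).
  case: z => /=; last by rewrite [RHS]big_mkcond.
  by rewrite big1.
(* The case [l = true], by induction on the slots. *)
have S_true g : c * slots_series b g =
    (~~ has id g)%:R + x * (c * slots_series b g * b) + y * S g.
  elim: g => [|z g IHg].
    by rewrite /S /= big_ord0 slot_nil mulr0 {1}def_c; ring.
  rewrite S_cons slot_cons; case: z => /=.
    have -> : y * (K * slots_series b g + 0) = b * slots_series b g.
      by rewrite [X in _ = X * _]def_b /K; ring.
    transitivity ((1 + x * (b * c)) * (b * slots_series b g)); last by ring.
    by rewrite -def_c.
  have -> : (~~ has id g)%:R + x * (c * ((1 + b) * slots_series b g) * b) +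
       y * (K * slots_series b g + S g) =
     ((~~ has id g)%:R + x * (c * slots_series b g * b) + y * S g) +
     (y * K + x * (b * c) * b) * slots_series b g by ring.
  rewrite -IHg -def_b.
  transitivity (c * slots_series b g + b * (1 + x * (b * c)) * slots_series b g); last by ring.
  by rewrite -def_c; ring.
case: l => /=.
  rewrite slot_rcons {1}S_true [c * (_ * b)]mulrA; congr (_ + _ + _ * _).
  by rewrite /S; apply: eq_bigl => i; rewrite orbT andbT.
rewrite slot_rcons; case: f => [|z g] /=.
  by rewrite big_ord0 slot_nil; ring.
rewrite big_mkcond big_ord_recl /= add0r slot_cons; case: z => /=.
  by rewrite big1 //; ring.
have -> : \sum_(i < size g) (if ~~ has id (take i g) && true
     then K * slots_series b (drop i.+1 g) else 0) = S g.
  by rewrite /S [in RHS]big_mkcond; apply: eq_bigr => i _; rewrite andbT.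
have -> : (~~ has id g)%:R + x * (c * ((1 + b) * slots_series b g * (1 + b))) + y * S g
   = ((~~ has id g)%:R + x * (c * slots_series b g * b) + y * S g)
     + (x * ((1 + b) ^+ 2 * c) - x * (b * c)) * slots_series b g by ring.
rewrite -S_true /K.
transitivity ((1 + x * (b * c)) * slots_series b g
  + (x * ((1 + b) ^+ 2 * c) - x * (b * c)) * slots_series b g); first by ring.
by rewrite -def_c.
Qed.

(** The value at [[::]] is [(1 + x) c], and multiplying the equation of [b] by
    [x c] turns it into a quadratic equation in [c] alone, as [x b c = c - 1]. *)
Lemma state_series_quadratic (b c : fps2 R) :
  c = 1 + x * (b * c) -> b = y * (1 + x * ((1 + b) ^+ 2 * c)) ->
  let A := state_series b c false [::] in
  y * (x + 1) * A ^+ 2 - (x * y + 2%:R * y + 1) * A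
    + (x + 1) * (y + 1) = 0.
Proof.
move=> def_c def_b /=.
have xbc : x * (b * c) = c - 1 by rewrite {2}def_c; ring.
have -> : 1 + x * (c * (1 + b)) = (1 + x) * c.
  by rewrite [RHS]mulrDl mul1r {2}def_c; ring.
have quad : c - 1 = y * (x * c + (x * c + (c - 1)) ^+ 2).
  by rewrite -{1}xbc {1}def_b -xbc; ring.
have -> : y * (x + 1) * ((1 + x) * c) ^+ 2
   - (x * y + 2%:R * y + 1) * ((1 + x) * c) + (x + 1) * (y + 1) =
  (1 + x) * (y * (x * c + (x * c + (c - 1)) ^+ 2) - (c - 1)) by ring.
by rewrite -quad subrr mulr0.
Qed.

End Weights.

(** * Appending a last entry to a permutation *)

Section Ordinals.
Local Open Scope nat_scope.
Variable m : nat.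

Lemma forall_ord_max (P : pred 'I_m.+1) :
  [forall i, P i] = [forall i : 'I_m, P (lift ord_max i)] && P ord_max.
Proof.
apply/forallP/andP => [allP | [/forallP allP Pmax] i]; last first.
  by case: (unliftP ord_max i) => [j ->|->].
by split; first apply/forallP => i.
Qed.

Lemma exists_ord_max (P : pred 'I_m.+1) :
  [exists i, P i] = [exists i : 'I_m, P (lift ord_max i)] || P ord_max.
Proof.
apply: negb_inj; rewrite negb_or !negb_exists.
exact: forall_ord_max.
Qed.

Lemma big_ord_max (R : Type) (idx : R) (op : Monoid.law idx) (P : pred 'I_m.+1)
    (F : 'I_m.+1 -> R) :
  \big[op/idx]_(i | P i) F i =
  op (\big[op/idx]_(i : 'I_m | P (lift ord_max i)) F (lift ord_max i))
     (if P ord_max then F ord_max else idx).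
Proof.
rewrite big_mkcond big_ord_recr [in RHS]big_mkcond /=; congr (op _ _).
by apply: eq_bigr => i _; rewrite (_ : widen_ord _ i = lift ord_max i) //;
  apply: val_inj; rewrite /= /bump leqNgt ltn_ord.
Qed.

Lemma ltn_max (i : 'I_m.+1) : ((ord_max : 'I_m.+1) < i) = false.
Proof. by rewrite ltnNge leq_ord. Qed.

Lemma ltn_bump h i j : (bump h i < bump h j) = (i < j).
Proof. by rewrite !ltnNge leq_bump2. Qed.

Definition ext (v : 'I_m.+1) (s : 'S_m) : 'S_m.+1 := lift_perm ord_max v s.

Lemma ext_max v s : ext v s ord_max = v. Proof. exact: lift_perm_id. Qed.

Lemma ext_lift v s i : ext v s (lift ord_max i) = bump v (s i) :> nat.
Proof. by rewrite /ext lift_perm_lift. Qed.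

(** Both sides have [(m+1)!] elements, so injectivity is enough. *)
Lemma ext_bij : bijective (fun vs : 'I_m.+1 * 'S_m => ext vs.1 vs.2).
Proof.
apply: inj_card_bij; last first.
  by rewrite card_prod card_ord; move: (card_Sn m) (card_Sn m.+1) => /= -> ->; rewrite factS.
move=> [v s] [w t] /= eq_ext.
have eq_vw : v = w by rewrite -(ext_max v s) eq_ext ext_max.
rewrite -{w}eq_vw in eq_ext *; congr (_, _); apply/permP => i.
apply: (@lift_inj _ v); rewrite -!(lift_perm_lift ord_max).
by rewrite -/(ext v s) eq_ext.
Qed.

Lemma ext_ind (Q : 'S_m.+1 -> Prop) : (forall v s, Q (ext v s)) -> forall s, Q s.
Proof. by move=> Qext s; have [g _ gK] := ext_bij; rewrite -[s]gK. Qed.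

Lemma big_ext (R : Type) (idx : R) (op : Monoid.com_law idx) (F : 'S_m.+1 -> R) :
  \big[op/idx]_s F s = \big[op/idx]_(s : 'S_m) \big[op/idx]_(v : 'I_m.+1) F (ext v s).
Proof.
rewrite exchange_big pair_bigA /=.
by rewrite (reindex (fun vs : 'I_m.+1 * 'S_m => ext vs.1 vs.2)) //; apply: onW_bij ext_bij.
Qed.

End Ordinals.

(** * The state of a permutation *)

Section Statistics.
Local Open Scope nat_scope.
Variable m : nat.
Implicit Type s : 'S_m.

(** The least value that can be appended without creating a 321 pattern. *)
Definition low s := \max_(i | ~~ ltr_maximum s i) (s i).+1.

(** The values [b - 1] and [b] occupy consecutive positions in this order, that
    is, slot [b] is bad. *)
Definition adj_at s b :=
  [exists j : 'I_m, exists j' : 'I_m,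
    [&& j' == j.+1 :> nat, s j' == (s j).+1 :> nat & s j' == b :> nat]].

(** The last value is [b - 1], so that appending [b] makes slot [b] bad; false
    for the empty permutation.  In particular [ends_at s m] says that the last
    entry of [s] is the greatest one. *)
Definition ends_at s b := [exists j : 'I_m, (j.+1 == m) && ((s j).+1 == b)].

Lemma low_le s : low s <= m.
Proof. by apply/bigmax_leqP. Qed.

Lemma low_lt s i : ~~ ltr_maximum s i -> s i < low s.
Proof. by move=> nltr; apply: (leq_bigmax_cond (F := fun i => (s i).+1)). Qed.

Lemma plus_irreducibleE s : plus_irreducible s = ~~ has (adj_at s) (iota 0 m).
Proof.
congr (~~ _); apply/existsP/hasP => [[j /existsP[j' /andP[jj' ss']]] | [b _]].
  exists (s j' : nat); first by rewrite mem_iota ltn_ord.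
  by apply/existsP; exists j; apply/existsP; exists j'; rewrite jj' ss' /=.
case/existsP=> j /existsP[j' /and3P[jj' ss' _]].
by exists j; apply/existsP; exists j'; rewrite jj'.
Qed.

Definition is_good s := avoids321 s && plus_irreducible s.

(** No pattern that is already beyond repair: a 321 pattern, or a bad slot in
    which any insertion creates a 321 pattern. *)
Definition alive s := avoids321 s && ~~ has (adj_at s) (iota 0 (low s)).

Definition flags s := [seq adj_at s b | b <- iota (low s) (m - low s)].

Lemma is_goodE s : is_good s = alive s && ~~ has id (flags s).
Proof.
rewrite /is_good /alive plus_irreducibleE has_map -(eq_has (a1 := adj_at s)) //.
have -> : iota 0 m = iota 0 (low s) ++ iota (low s) (m - low s).
  by rewrite -iotaD subnKC ?low_le.
by rewrite has_cat negb_or andbA.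
Qed.
End Statistics.

(** * How the statistics change when an entry is appended *)

Section Insertion.
Local Open Scope nat_scope.
Variables (m : nat) (v : 'I_m.+1) (s : 'S_m).

Lemma ltr_ext_lift i : ltr_maximum (ext v s) (lift ord_max i) = ltr_maximum s i.
Proof.
rewrite /ltr_maximum forall_ord_max; cbv beta.
rewrite ltn_max implyFb andbT; apply: eq_forallb => j /[!lift_max].
by rewrite !ext_lift ltn_bump.
Qed.

(** If [v] is not the top value, the old entry of value [v] is pushed above the
    appended one. *)
Lemma ltr_ext_max : ltr_maximum (ext v s) ord_max = (v == ord_max).
Proof.
rewrite /ltr_maximum forall_ord_max; cbv beta; rewrite ltnn andbT ext_max.
apply/forallP/eqP => [allv | -> j]; last first.
  by move: (ltn_ord (s j)); rewrite ext_lift /= /bump; lia.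
apply: val_inj => /=; apply/eqP; rewrite eqn_leq -ltnS ltn_ord /= leqNgt.
apply/negP => lt_vm; have := allv (s^-1 (Ordinal lt_vm))%g.
by rewrite lift_max ltn_ord ext_lift permKV /= /bump leqnn add1n ltnNge leqnSn.
Qed.

Lemma card_ltr_ext :
  #|[set i | ltr_maximum (ext v s) i]| = #|[set i | ltr_maximum s i]| + (v == ord_max).
Proof.
rewrite -!sum1_card !(eq_bigl _ _ (fun i => in_set _ i)) big_ord_max /=.
rewrite ltr_ext_max; congr (_ + _).
by apply: eq_bigl => i; rewrite ltr_ext_lift.
Qed.

Lemma card_nltr_ext :
  #|[set i | ~~ ltr_maximum (ext v s) i]| =
  #|[set i | ~~ ltr_maximum s i]| + (v != ord_max).
Proof.
rewrite -!sum1_card !(eq_bigl _ _ (fun i => in_set _ i)) big_ord_max /=.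
rewrite ltr_ext_max; congr (_ + _).
by apply: eq_bigl => i; rewrite ltr_ext_lift.
Qed.

Lemma ends_at_ext b : ends_at (ext v s) b = (v.+1 == b).
Proof.
rewrite /ends_at exists_ord_max ext_max eqxx /=.
case: existsP => // -[j] /andP[/eqP eq_j _].
by move: eq_j (ltn_ord j); rewrite /bump; lia.
Qed.

Lemma low_ext : low s <= v ->
  low (ext v s) = if v == ord_max then low s else v.+1.
Proof.
move=> le_v; rewrite /low big_ord_max ltr_ext_max ext_max /=.
have -> : \max_(i | ~~ ltr_maximum (ext v s) (lift ord_max i)) (ext v s (lift ord_max i)).+1
   = low s.
  apply: eq_big => [i|i nltr]; first by rewrite ltr_ext_lift.
  rewrite ltr_ext_lift in nltr; rewrite ext_lift.
  by rewrite /bump leqNgt (leq_trans (low_lt nltr) le_v).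
case: eqP => _ /=; first by rewrite maxn0.
by apply/maxn_idPr; apply: leqW.
Qed.

(** A new 321 pattern ends with the appended entry, so its middle entry is not a
    left-to-right maximum and has value at least [v]. *)
Lemma avoids321_ext : avoids321 (ext v s) = avoids321 s && (low s <= v).
Proof.
apply/idP/andP => [av | [av le_v]].
  split; last first.
    rewrite leqNgt; apply: contra av => lt_v.
    have [i nltr lt_vi] : exists2 i, ~~ ltr_maximum s i & v <= s i.
      case: (boolP [exists i, ~~ ltr_maximum s i && (v <= s i)]) => [|/existsPn none].
        by case/existsP=> i /andP[]; exists i.
      move: lt_v; rewrite ltnNge; case/negP; apply/bigmax_leqP => i nltr.
      by have := none i; rewrite nltr /= -ltnNge.
    case/forallPn: nltr => j; rewrite negb_imply -leqNgt => /andP[lt_ji le_ij].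
    apply/existsP; exists (lift ord_max j); apply/existsP; exists (lift ord_max i).
    apply/existsP; exists ord_max; rewrite !lift_max lt_ji ltn_ord !ext_lift ext_max.
    rewrite ltn_bump /= ltn_neqAle le_ij andbT.
    rewrite (inj_eq val_inj) (inj_eq perm_inj) -(inj_eq val_inj) gtn_eqF //=.
    by rewrite /bump lt_vi.
  apply: contra av => /existsP[i /existsP[j /existsP[k /and4P[ij jk sij sjk]]]].
  apply/existsP; exists (lift ord_max i); apply/existsP; exists (lift ord_max j).
  apply/existsP; exists (lift ord_max k).
  by rewrite !lift_max !ext_lift !ltn_bump ij jk sij.
apply/negP => /existsP[i /existsP[j /existsP[k]]].
case: (unliftP ord_max i) => [i'|] ->; last by rewrite ltn_max.
case: (unliftP ord_max j) => [j'|] ->; last by rewrite ltn_max andbF.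
rewrite !lift_max !ext_lift ltn_bump.
case: (unliftP ord_max k) => [k'|] ->; rewrite ?lift_max ?ext_lift ?ltn_bump.
  move=> H; case/negP: av; apply/existsP; exists i'; apply/existsP; exists j'.
  by apply/existsP; exists k'.
rewrite ext_max => /and4P[ij _ sij].
have nltr : ~~ ltr_maximum s j'.
  by apply/forallPn; exists i'; rewrite negb_imply ij -leqNgt ltnW.
have lt_jv : s j' < v by apply: leq_trans (low_lt nltr) le_v.
by rewrite /bump; lia.
Qed.

(** Appending [v] separates the values that were around slot [v], makes [v] bad
    only if it follows [v - 1], and shifts the other bad slots. *)
Lemma adj_at_ext b : adj_at (ext v s) b =
  if b == v then ends_at s v
  else (b != v.+1) && adj_at s (unbump v b).
Proof.
have old (j j' : 'I_m) :
  [&& lift ord_max j' == (lift ord_max j).+1 :> nat,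
      ext v s (lift ord_max j') == (ext v s (lift ord_max j)).+1 :> nat
    & ext v s (lift ord_max j') == b :> nat] =
  [&& b != v, b != v.+1 & [&& j' == j.+1 :> nat, s j' == (s j).+1 :> nat
                            & s j' == unbump v b :> nat]].
  by rewrite !lift_max !ext_lift /bump /unbump; lia.
have new (j : 'I_m) :
  [&& (ord_max : 'I_m.+1) == (lift ord_max j).+1 :> nat,
      ext v s ord_max == (ext v s (lift ord_max j)).+1 :> nat
    & ext v s ord_max == b :> nat] =
  (b == v) && ((j.+1 == m) && ((s j).+1 == v)).
  by rewrite lift_max ext_lift ext_max /bump /=; lia.
have none (j' : 'I_m.+1) : (j' == (ord_max : 'I_m.+1).+1 :> nat) = false.
  by rewrite /= ltn_eqF // ltn_ord.
have split_j (j : 'I_m) :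
  [exists j' : 'I_m.+1, [&& j' == (lift ord_max j).+1 :> nat,
      ext v s j' == (ext v s (lift ord_max j)).+1 :> nat & ext v s j' == b :> nat]] =
  [&& b != v, b != v.+1 &
    [exists j' : 'I_m, [&& j' == j.+1 :> nat, s j' == (s j).+1 :> nat
                         & s j' == unbump v b :> nat]]]
  || (b == v) && ((j.+1 == m) && ((s j).+1 == v)).
  rewrite exists_ord_max; cbv beta; rewrite new; congr (_ || _).
  apply/existsP/and3P => [[j'] | [ne_bv ne_bv1 /existsP[j' adj_jj']]].
    rewrite old => /and3P[-> -> adj_jj']; split=> //.
    by apply/existsP; exists j'.
  by exists j'; rewrite old ne_bv ne_bv1.
rewrite /adj_at exists_ord_max [X in _ || X](_ : _ = false); last first.
  by apply/existsP => -[j']; rewrite none.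
rewrite orbF (eq_existsb split_j) => {old new none split_j}.
case: (b == v) => /=; first by [].
rewrite -(eq_existsb (fun j => esym (orbF _))).
case: (b != v.+1) => //=.
by apply/existsP => -[].
Qed.

Lemma adj_at_ext_lt b : b < v -> adj_at (ext v s) b = adj_at s b.
Proof. by move=> lt_bv; rewrite adj_at_ext /unbump !ltn_eqF ?leqW //= ltnNge ltnW // subn0. Qed.

Lemma adj_at_ext_gt b : v < b -> adj_at (ext v s) b.+1 = adj_at s b.
Proof.
move=> lt_vb; rewrite adj_at_ext /unbump ltnS (ltnW lt_vb) subn1 /= eqSS.
by rewrite (gtn_eqF lt_vb) gtn_eqF // leqW.
Qed.

End Insertion.

(** * The moves between states *)

Section Step.
Local Open Scope nat_scope.

(** If the last entry is not the greatest one, it is the largest of the entries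
    that are not left-to-right maxima, since these increase.  Its value is then
    [low s - 1], so only the lowest slot would extend it to a pattern
    [i (i+1)]. *)
Lemma ends_at_nonmax m (s : 'S_m) u : avoids321 s -> low s <= u < m ->
  ends_at s u = (u == low s) && ~~ ends_at s m.
Proof.
case: m s => [|m]; first by move=> s _; rewrite ltn0 andbF.
apply: ext_ind => v s; rewrite avoids321_ext !ends_at_ext => /andP[_ /low_ext ->].
case: (v =P ord_max) => [-> /andP[_ lt_um]|ne_v _].
  by rewrite eqxx andbF gtn_eqF.
have ne_vm : v != m :> nat by apply: contra_notN ne_v => /eqP ?; apply: val_inj.
by rewrite eqSS ne_vm andbT eq_sym.
Qed.

Variables (m : nat) (s : 'S_m).

Lemma alive_ext_max : alive (ext ord_max s) = alive s.
Proof.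
rewrite /alive avoids321_ext low_ext ?low_le // eqxx andbT; congr (_ && ~~ _).
apply: eq_in_has => b; rewrite mem_iota => /andP[_ lt_b].
by rewrite adj_at_ext_lt // (leq_trans lt_b) ?low_le.
Qed.

Lemma flags_ext_max : flags (ext ord_max s) = rcons (flags s) (ends_at s m).
Proof.
rewrite /flags low_ext ?low_le // eqxx subSn ?low_le //.
have -> : iota (low s) (m - low s).+1 = rcons (iota (low s) (m - low s)) m.
  by rewrite -[in LHS]addn1 iotaD cats1 subnKC ?low_le.
rewrite map_rcons adj_at_ext eqxx; congr rcons.
apply/eq_in_map => b; rewrite mem_iota subnKC ?low_le // => /andP[_ lt_b].
by rewrite adj_at_ext_lt.
Qed.

Variable v : 'I_m.+1.

Lemma not_alive_ext_low : v < low s -> alive (ext v s) = false.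
Proof. by move=> lt_v; rewrite /alive avoids321_ext leqNgt lt_v andbF. Qed.

Hypothesis v_range : low s <= v < m.

Let v_ge : low s <= v. Proof. by case/andP: v_range. Qed.
Let v_lt : v < m. Proof. by case/andP: v_range. Qed.
Let v_ne : (v == ord_max) = false.
Proof. by rewrite -(inj_eq val_inj) /= ltn_eqF. Qed.

Let low_mid : low (ext v s) = v.+1. Proof. by rewrite low_ext // v_ne. Qed.

(** The slots that the insertion leaves below it must be good; slot [v] itself,
    even if bad, is repaired by it, but becomes bad again for good if it is the
    lowest one and the last entry is [v - 1]. *)
Lemma alive_ext_mid : alive (ext v s) =
  [&& alive s, ~~ has id (take (v - low s) (flags s))
    & (0 < v - low s) || ends_at s m].
Proof.
rewrite /alive avoids321_ext v_ge andbT low_mid -!andbA.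
case: (boolP (avoids321 s)) => // av; rewrite !andTb.
have -> : iota 0 v.+1 = iota 0 (low s) ++ iota (low s) (v - low s) ++ [:: v : nat].
  by rewrite catA -iotaD subnKC // -(iotaD 0 v 1) addn1.
have -> : has id (take (v - low s) (flags s)) =
    has (adj_at s) (iota (low s) (v - low s)).
  rewrite /flags -map_take take_iota has_map; congr (has _ (iota _ _)).
  by apply/minn_idPl; rewrite leq_sub2r // ltnW.
rewrite !has_cat !negb_or.
have -> : has (adj_at (ext v s)) (iota 0 (low s)) = has (adj_at s) (iota 0 (low s)).
  apply: eq_in_has => b; rewrite mem_iota => /andP[_ lt_b].
  by rewrite adj_at_ext_lt // (leq_trans lt_b).
have -> : has (adj_at (ext v s)) (iota (low s) (v - low s)) =
    has (adj_at s) (iota (low s) (v - low s)).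
  apply: eq_in_has => b; rewrite mem_iota subnKC // => /andP[_ lt_b].
  by rewrite adj_at_ext_lt.
congr [&& _, _ & _].
rewrite andbT adj_at_ext eqxx ends_at_nonmax // negb_and negbK.
by rewrite subn_gt0 ltn_neqAle v_ge andbT eq_sym.
Qed.

Lemma flags_ext_mid :
  flags (ext v s) = false :: drop (v - low s).+1 (flags s).
Proof.
rewrite /flags low_mid subSS -map_drop drop_iota.
rewrite addnS subnKC // subnS -subnDA subnKC //.
rewrite -[m - v]prednK ?subn_gt0 //= adj_at_ext gtn_eqF // eqxx /=; congr (_ :: _).
rewrite -[v.+2]add1n iotaDl -map_comp; apply/eq_in_map => b.
by rewrite mem_iota => /andP[lt_vb _]; apply: adj_at_ext_gt.
Qed.

End Step.

(** * Counting the completions *)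

Section Counting.

Local Notation x := (fps2_X int).
Local Notation y := (fps2_Y int).

Definition weight m (s : 'S_m) : fps2 int :=
  fps2_monom int #|[set i | ltr_maximum s i]| #|[set i | ~~ ltr_maximum s i]|.

(** The good permutations obtained from [s] by [r] more insertions, each weighted
    by the monomial that records the kinds of the inserted entries. *)
Fixpoint completions r : forall m, 'S_m -> fps2 int :=
  if r is r'.+1 then
    fun m s => \sum_(v : 'I_m.+1) (if v == ord_max then x else y) * completions r' (ext v s)
  else fun m s => (is_good s)%:R.

Lemma weight_ext m (v : 'I_m.+1) (s : 'S_m) :
  weight (ext v s) = weight s * (if v == ord_max then x else y).
Proof.
rewrite /weight card_ltr_ext card_nltr_ext.
by case: (v == ord_max); rewrite /fps2_X /fps2_Y fps2_monomM.
Qed.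

(** Every permutation of [r + m] values arises exactly once from one of [m]
    values by [r] insertions. *)
Lemma sum_completions r m :
  \sum_(s : 'S_m) weight s * completions r s =
  \sum_(s : 'S_(r + m)) weight s * (is_good s)%:R.
Proof.
elim: r m => [|r IHr] m //.
rewrite addSnnS -IHr [RHS]big_ext; apply: eq_bigr => s _ /=.
by rewrite big_distrr; apply: eq_bigr => v _; rewrite weight_ext -mulrA.
Qed.

Lemma perm0_unique (s : 'S_0) : s = 1%g.
Proof. by apply/permP => -[]. Qed.

Lemma coef_weight m (s : 'S_m) n k : (weight s * (is_good s)%:R) n k =
  [&& is_good s, #|[set i | ltr_maximum s i]| == n
    & #|[set i | ~~ ltr_maximum s i]| == k]%:R.
Proof.
case: (is_good s); last by rewrite mulr0.
by rewrite mulr1 /= (eq_sym n) (eq_sym k).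
Qed.

Lemma A_plus_irr_completions n k : A_plus_irr n k = completions (n + k) (1%g : 'S_0) n k.
Proof.
have := sum_completions (n + k) 0; rewrite addn0 (bigD1 (1%g : 'S_0)) //= big1; last first.
  by move=> s; rewrite (perm0_unique s) eqxx.
rewrite addr0 /weight !eq_card0 ?mul1r => [->|[]//|[]//].
rewrite coef_fps2_sum (eq_bigr _ (fun s _ => coef_weight s n k)).
rewrite -[LHS]/((num_plus_irr n k)%:Z) -natz /num_plus_irr cardsE.
rewrite -sum1_card big_mkcond natr_sum; apply: eq_bigr => s _.
by rewrite -topredE /= andbA -/(is_good s); case: ifP.
Qed.

(** A 321 pattern persists, and so does a bad slot below [low s] unless the
    insertion creates a 321 pattern. *)
Lemma completions_dead r m (s : 'S_m) : ~~ alive s -> completions r s = 0.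
Proof.
elim: r m s => [|r IHr] m s dead /=.
  by rewrite is_goodE (negbTE dead).
rewrite big1 // => v _; rewrite IHr ?mulr0 //.
case: (v =P ord_max) => [->|/eqP ne_v]; first by rewrite alive_ext_max.
have lt_v : (v < m)%N.
  by rewrite ltn_neqAle -ltnS ltn_ord andbT; apply: contra ne_v => /eqP ?; apply/eqP/val_inj.
case: (ltnP v (low s)) => [/not_alive_ext_low -> // | le_v].
by rewrite alive_ext_mid ?le_v // (negbTE dead).
Qed.

(** The moves between states and [state_series_rec] give the same recursion on
    both sides; taking homogeneous parts makes it well founded, because every
    insertion contributes a factor x or y. *)
Lemma completions_state_series (b c : fps2 int) r m (s : 'S_m) :
  c = 1 + x * (b * c) -> b = y * (1 + x * ((1 + b) ^+ 2 * c)) ->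
  alive s -> completions r s = hom r (state_series b c (ends_at s m) (flags s)).
Proof.
move=> def_c def_b; elim: r m s => [|r IHr] m s alive_s.
  rewrite (state_series_rec _ _ def_c def_b) !homD hom_XM hom_YM !addr0 hom_bool /=.
  by rewrite is_goodE alive_s.
rewrite (state_series_rec _ _ def_c def_b) !homD hom_XM hom_YM hom_bool add0r /=.
rewrite big_ord_recr /= addrC; congr (_ + _).
  by rewrite eqxx IHr ?alive_ext_max // flags_ext_max ends_at_ext eqxx.
(* The summand is extended to all of [nat], so that the range can be split at
   [low s] and shifted. *)
pose step (v : nat) := if insub v is Some w then
  (if w == ord_max then x else y) * completions r (ext w s) else 0.
have stepE (w : 'I_m.+1) :
  (if w == ord_max then x else y) * completions r (ext w s) = step w.
  by rewrite /step valK.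
transitivity (\sum_(0 <= v < m) step v).
  by rewrite big_mkord; apply: eq_bigr => v _; apply: stepE.
rewrite (big_cat_nat (n := low s)) ?low_le //= big_nat big1 ?add0r => [|v /= lt_v]; last first.
  rewrite /step; case: insubP => [w _ def_w|//].
  by rewrite completions_dead ?mulr0 // not_alive_ext_low ?def_w.
rewrite -{1}[low s]add0n big_addn big_mkord hom_sum big_distrr /=.
rewrite /flags size_map size_iota -/(flags s) [in RHS]big_mkcond.
apply: eq_bigr => i _.
have lt_im : (i + low s < m)%N by rewrite addnC -ltn_subRL ltn_ord.
have range : (low s <= i + low s < m)%N by rewrite leq_addl.
pose w := Ordinal (ltnW lt_im : (i + low s < m.+1)%N).
rewrite -[(i + low s)%N]/(w : nat) -stepE.
rewrite -[w == _](inj_eq val_inj) /= ltn_eqF //.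
have := @alive_ext_mid m s w range; rewrite /= addnK alive_s /= => alive_w.
case: ifP alive_w => [_ | _] alive_w; last by rewrite completions_dead ?alive_w ?mulr0.
rewrite IHr ?alive_w // flags_ext_mid //= addnK ends_at_ext eqSS ltn_eqF //.
Qed.

End Counting.

Theorem mainTheorem1 :
  let x : fps2 int := fps2_monom int 1%N 0%N in
  let y : fps2 int := fps2_monom int 0%N 1%N in
  let A : fps2 int := A_plus_irr in
  y * (x + 1) * A ^+ 2 - (x * y + 2%:R * y + 1) * A + (x + 1) * (y + 1) = 0.
Proof.
move=> x y A; have [b [c [def_c def_b]]] := exists_slot_series int.
suff -> : A = state_series b c false [::] by apply: state_series_quadratic.
apply/fps2P => n k; rewrite /A A_plus_irr_completions.
have low0 : low (1%g : 'S_0) = 0%N by rewrite /low big_ord0.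
have alive0 : alive (1%g : 'S_0).
  by rewrite /alive low0 andbT; apply/existsP => -[[]].
have ends0 : ends_at (1%g : 'S_0) 0 = false by apply/existsP => -[[]].
by rewrite (completions_state_series _ def_c def_b alive0) ends0 /flags low0 /= eqxx.
Qed.
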